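(* Let $\mathcal{D}$ be a dialgebra over a field $K$ of characteristic zero and let $\delta$ be a diderivation of $\mathcal{D}$. Then: (a) $\delta(\mathcal{D}^{ann})=\{0\}$; (b) $x\vdash\delta(z)=\delta(z)\dashv x=0$ for every $x\in\mathcal{D}$ and $z\in Z_B(\mathcal{D})$; (c) if $\mathcal{D}$ is a unital dialgebra, then $\delta(\mathcal{H}(\mathcal{D}))=\delta(Z_B(\mathcal{D}))=\{0\}$.
   Context: A dialgebra over $K$ is a $K$-vector space $\mathcal{D}$ with two bilinear associative products $\vdash,\dashv:\mathcal{D}\times\mathcal{D}\to\mathcal{D}$ satisfying, for all $x,y,z\in\mathcal{D}$: $x\dashv(y\dashv z)=x\dashv(y\vdash z)$, $(x\dashv y)\vdash z=(x\vdash y)\vdash z$, and $x\vdash(y\dashv z)=(x\vdash y)\dashv z$. A diderivation of $\mathcal{D}$ is a $K$-linear map $\delta:\mathcal{D}\to\mathcal{D}$ such that $\delta(a*b)=\delta(a)\dashv b+a\vdash\delta(b)$ for all $a,b\in\mathcal{D}$ and for each $*\in\{\vdash,\dashv\}$. $\mathcal{D}^{ann}$ is the linear span of all elements $a\dashv b-a\vdash b$ with $a,b\in\mathcal{D}$. $Z_B(\mathcal{D})=\{z\in\mathcal{D} : z\vdash x=0=x\dashv z\text{ for all }x\in\mathcal{D}\}$. A bar unit is an element $e\in\mathcal{D}$ with $e\vdash x=x\dashv e=x$ for all $x\in\mathcal{D}$; the halo $\mathcal{H}(\mathcal{D})$ is the set of all bar units; $\mathcal{D}$ is unital if it has a (fixed)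 bar unit. *)

(* Defs.v *)
From HB Require Import structures.
From mathcomp Require Import all_boot all_algebra.
From mathcomp Require Import boolp classical_sets.

Set Implicit Arguments.
Unset Strict Implicit.
Unset Printing Implicit Defensive.

Import GRing.Theory.
Local Open Scope ring_scope.
Local Open Scope classical_set_scope.

HB.mixin Record Lmodule_isDialgebra (K : fieldType) D of GRing.Lmodule K D := {
  vdash : {bilinear D -> D -> D};
  dashv : {bilinear D -> D -> D};
  vdashA : associative vdash;
  dashvA : associative dashv;
  dashv_bar : forall x y z : D, dashv x (dashv y z) = dashv x (vdash y z);
  vdash_bar : forall x y z : D, vdash (dashv x y) z = vdash (vdash x y) z;
  vdash_dashvA : forall x y z : D, vdash x (dashv y z) = dashv (vdash x y) z
}.

#[short(type="dialgebraType")]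
HB.structure Definition Dialgebra (K : fieldType) :=
  {D of Lmodule_isDialgebra K D & GRing.Lmodule K D}.

Declare Scope dialgebra_scope.
Delimit Scope dialgebra_scope with dialg.
Notation "x ⊢ y" := (vdash x y)
  (at level 45, no associativity) : dialgebra_scope.
Notation "x ⊣ y" := (dashv x y)
  (at level 45, no associativity) : dialgebra_scope.
Local Open Scope dialgebra_scope.

Definition linear_span (K : fieldType) (V : lmodType K) (A : set V) : set V :=
  [set v | exists (n : nat) (c : 'I_n -> K) (a : 'I_n -> V),
    (forall i, A (a i)) /\ v = \sum_(i < n) c i *: a i].

Definition is_diderivation (K : fieldType) (D : dialgebraType K)
    (delta : {linear D -> D}) : Prop :=
  (forall a b : D, delta (a ⊢ b) = (delta a ⊣ b) + (a ⊢ delta b)) /\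
  (forall a b : D, delta (a ⊣ b) = (delta a ⊣ b) + (a ⊢ delta b)).

Definition ann_ideal (K : fieldType) (D : dialgebraType K) : set D :=
  linear_span [set v | exists a b : D, v = (a ⊣ b) - (a ⊢ b)].
Arguments ann_ideal {K} D.

Definition Z_B (K : fieldType) (D : dialgebraType K) : set D :=
  [set z | forall x : D, z ⊢ x = 0 /\ x ⊣ z = 0].
Arguments Z_B {K} D.

Definition halo (K : fieldType) (D : dialgebraType K) : set D :=
  [set e | forall x : D, e ⊢ x = x /\ x ⊣ e = x].
Arguments halo {K} D.

Definition unital (K : fieldType) (D : dialgebraType K) : Prop :=
  exists e : D, halo D e.
Arguments unital {K} D.

(* Main.v *)
Require Import Defs.
From mathcomp Require Import all_boot all_algebra.
From mathcomp Require Import boolp classical_sets.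

Import GRing.Theory.
Local Open Scope ring_scope.
Local Open Scope classical_set_scope.
Local Open Scope dialgebra_scope.

(** A diderivation [delta] obeys the same Leibniz formula for both products, so
    it kills every [(a ⊣ b) - (a ⊢ b)] and hence their span.  For [z] in [Z_B D],
    applying [delta] to [z ⊢ x = 0] and to [x ⊣ z = 0] leaves
    [delta z ⊣ x = 0] and [x ⊢ delta z = 0], because the other Leibniz term is a
    product with [z] that vanishes; taking [x] to be a bar unit in the second
    equation gives [delta z = 0].  Finally, [e ⊢ e = e] for a bar unit [e], so
    the Leibniz formula reads [delta e = delta e + delta e], and [delta e = 0]
    by cancellation. *)

Lemma image_eq_singleton0 {T : Type} {V : nmodType} (f : T -> V) (A : set T) :
  A !=set0 -> (forall x, A x -> f x = 0) -> f @` A = [set 0].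
Proof.
move=> [x0 Ax0] fA0; apply/seteqP; split => [_ [x Ax <-]|_ ->]; first exact: fA0.
by exists x0 => //; exact: fA0.
Qed.

Lemma linear_span0 {K : fieldType} {V : lmodType K} (A : set V) :
  linear_span A 0.
Proof.
exists 0, (fun=> 0), (fun=> 0); split=> [[]//|].
by rewrite big_ord0.
Qed.

Lemma linear_eq0_span {K : fieldType} {V W : lmodType K} (f : {linear V -> W})
    (A : set V) :
  (forall v, A v -> f v = 0) -> forall v, linear_span A v -> f v = 0.
Proof.
move=> fA0 _ [n [c [a [Aa ->]]]]; rewrite linear_sum big1 // => i _.
by rewrite linearZ /= fA0 ?scaler0.
Qed.

Lemma Z_B0 {K : fieldType} (D : dialgebraType K) : Z_B D 0.
Proof. by move=> x; rewrite linear0l linear0r. Qed.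

Section Diderivation.
Context {K : fieldType} {D : dialgebraType K} {delta : {linear D -> D}}.
Hypothesis delta_der : is_diderivation delta.

Lemma diderivation_ann_ideal (v : D) : ann_ideal D v -> delta v = 0.
Proof.
move: v; apply: linear_eq0_span => _ [a [b ->]].
by rewrite linearB /= delta_der.1 delta_der.2 subrr.
Qed.

Lemma diderivation_Z_B (x z : D) :
  Z_B D z -> x ⊢ delta z = 0 /\ delta z ⊣ x = 0.
Proof.
move=> Zz; split.
- have := delta_der.2 x z.
  by rewrite (Zz x).2 (Zz (delta x)).2 linear0 add0r.
- have := delta_der.1 z x.
  by rewrite (Zz x).1 (Zz (delta x)).1 linear0 addr0.
Qed.

Lemma diderivation_halo (e : D) : halo D e -> delta e = 0.
Proof.
move=> He; have := delta_der.1 e e.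
rewrite (He e).1 (He (delta e)).1 (He (delta e)).2 => de2.
by apply: (addrI (delta e)); rewrite addr0.
Qed.

Lemma diderivation_unital_Z_B (z : D) : unital D -> Z_B D z -> delta z = 0.
Proof. by move=> [e He] Zz; rewrite -(He (delta z)).1 (diderivation_Z_B e _ Zz).1. Qed.

End Diderivation.

Theorem lemma2p14 (K : fieldType) (charK0 : [pchar K] =i pred0)
    (D : dialgebraType K) (delta : {linear D -> D})
    (delta_der : is_diderivation delta) :
  [/\ delta @` ann_ideal D = [set 0],
      (forall x z : D, Z_B D z -> x ⊢ delta z = 0 /\ delta z ⊣ x = 0) &
      (unital D -> delta @` halo D = [set 0] /\ delta @` Z_B D = [set 0])].
Proof.
split.
- apply: image_eq_singleton0; first by exists 0; exact: linear_span0.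
  exact: diderivation_ann_ideal.
- exact: diderivation_Z_B.
- move=> D1; split; apply: image_eq_singleton0.
  + exact: D1.
  + exact: diderivation_halo.
  + by exists 0; exact: Z_B0.
  + by move=> z; exact: diderivation_unital_Z_B.
Qed.
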